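(* Let $\mathcal{X}$ be a real Banach space with $\dim(\mathcal{X})\ge 2$ and let $\kappa,\tau>0$. Then $\mathcal{X}$ is not uniformly non-square if and only if $\mathcal{T}_2(\kappa,\tau,\mathcal{X})=\kappa+\tau$.
   Context: $S_{\mathcal{X}}$ denotes the unit sphere of $\mathcal{X}$. For $\kappa,\tau>0$, $$\mathcal{T}_2(\kappa,\tau,\mathcal{X})=\sup_{x_1,x_2\in S_{\mathcal{X}}}\big(\|\kappa x_1+\tau x_2\|\,\|\tau x_1-\kappa x_2\|\big)^{1/2}.$$ $\mathcal{X}$ is uniformly non-square if there exists $\delta\in(0,1)$ such that for all $x_1,x_2\in S_{\mathcal{X}}$, $\min\left\{\left\|\frac{x_1+x_2}{2}\right\|,\left\|\frac{x_1-x_2}{2}\right\|\right\}\le 1-\delta$. *)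

(* Defs.v *)
From HB Require Import structures.
From mathcomp Require Import all_boot all_order all_algebra.
From mathcomp Require Import all_classical all_reals all_analysis.
Import Order.TTheory GRing.Theory Num.Theory numFieldNormedType.Exports.

Set Implicit Arguments.
Unset Strict Implicit.
Unset Printing Implicit Defensive.

Local Open Scope classical_set_scope.
Local Open Scope ring_scope.

(* dim V >= n for a possibly infinite-dimensional V, which has no [\dim]:
   some n vectors of V are linearly independent. *)
Definition dim_ge (R : realType) (V : lmodType R) (n : nat) : Prop :=
  exists e : 'I_n -> V,
    forall a : 'I_n -> R, \sum_(i < n) a i *: e i = 0 -> forall i, a i = 0.

Definition unit_sphere (R : realType) (X : normedModType R) : set X :=
  [set x | `|x| = 1].

(* The real-valued [sup] is harmless: for 0 < kappa, tau and X nonzero, the set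
   is nonempty and bounded above by kappa + tau. *)
Definition T2 (R : realType) (kappa tau : R) (X : normedModType R) : R :=
  sup [set t | exists x1 x2 : X,
         [/\ unit_sphere x1, unit_sphere x2 &
             t = Num.sqrt (`|kappa *: x1 + tau *: x2|
                           * `|tau *: x1 - kappa *: x2|)]].

Definition uniformly_nonsquare (R : realType) (X : normedModType R) : Prop :=
  exists delta : R, 0 < delta < 1 /\
    forall x1 x2 : X, unit_sphere x1 -> unit_sphere x2 ->
      Num.min `|2^-1 *: (x1 + x2)| `|2^-1 *: (x1 - x2)| <= 1 - delta.

(* Main.v *)
Require Import Defs.
From mathcomp Require Import all_boot all_order all_algebra.
From mathcomp Require Import all_classical all_reals all_analysis.
From mathcomp Require Import lra.
Import Order.TTheory GRing.Theory Num.Theory numFieldNormedType.Exports.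
Local Open Scope ring_scope.

(** Write d := 2 - |x + y| for the defect in the triangle inequality for two
    unit vectors.  The defect a + b - |a *: x + b *: y| of a combination with
    positive coefficients is comparable to it: it lies between [min a b * d]
    and [max a b * d] ([norm_comb_le], [norm_comb_ge]).  Applied to the pairs
    (x1, x2) and (x1, - x2), this says that both factors in the definition of
    [T2] are close to kappa + tau exactly when both |x1 + x2| and |x1 - x2| are
    close to 2.  As no factor exceeds kappa + tau, their geometric mean is close
    to kappa + tau exactly when both of them are; hence the supremum [T2] is
    kappa + tau if and only if there are unit vectors x1, x2 with |x1 + x2| and
    |x1 - x2| simultaneously arbitrarily close to 2, which is the failure of
    uniform non-squareness. *)

Section UnitVectors.
Set Implicit Arguments.
Unset Strict Implicit.
Variables (R : realType) (X : normedModType R).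
Implicit Types (x y : X) (a b : R).

Lemma norm_comb_le_add x y a b : `|x| = 1 -> `|y| = 1 -> 0 <= a -> 0 <= b ->
  `|a *: x + b *: y| <= a + b.
Proof.
move=> x1 y1 a0 b0; apply: le_trans (ler_normD _ _) _.
by rewrite !normrZ x1 y1 !mulr1 !ger0_norm.
Qed.

(** For b <= a the combination is b *: (x + y) + (a - b) *: x: only the
    summand carrying the smaller coefficient sees the defect. *)
Lemma norm_comb_le x y a b : `|x| = 1 -> `|y| = 1 -> 0 <= a -> 0 <= b ->
  `|a *: x + b *: y| <= a + b - Num.min a b * (2 - `|x + y|).
Proof.
wlog ba : x y a b / b <= a.
  move=> H x1 y1 a0 b0; case/orP: (le_total b a) => ba; first exact: H.
  by rewrite (addrC (a *: x)) (addrC a) (addrC x) minC; exact: H.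
move=> x1 y1 a0 b0; rewrite (min_idPr ba).
have -> : a *: x + b *: y = b *: (x + y) + (a - b) *: x.
  by rewrite scalerDr addrAC -scalerDl [b + _]addrC subrK.
apply: le_trans (ler_normD _ _) _.
rewrite !normrZ x1 (ger0_norm b0) ger0_norm ?subr_ge0//; lra.
Qed.

(** For b <= a, completing b *: y to a *: y costs at most a - b and
    turns the combination into a *: (x + y). *)
Lemma norm_comb_ge x y a b : `|x| = 1 -> `|y| = 1 -> 0 <= a -> 0 <= b ->
  a + b - Num.max a b * (2 - `|x + y|) <= `|a *: x + b *: y|.
Proof.
wlog ba : x y a b / b <= a.
  move=> H x1 y1 a0 b0; case/orP: (le_total b a) => ba; first exact: H.
  by rewrite (addrC (a *: x)) (addrC a) (addrC x) maxC; exact: H.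
move=> x1 y1 a0 b0; rewrite (max_idPl ba).
have : `|a *: (x + y)| <= `|a *: x + b *: y| + `|(a - b) *: y|.
  have -> : a *: (x + y) = (a *: x + b *: y) + (a - b) *: y.
    by rewrite scalerDr -addrA -scalerDl [b + _]addrC subrK.
  exact: ler_normD.
rewrite !normrZ y1 (ger0_norm a0) [`|a - b|]ger0_norm ?subr_ge0//; lra.
Qed.

End UnitVectors.

Section GeometricMean.
Variable R : rcfType.
Implicit Types p q s M : R.

Lemma le_sqrt_mul s p q : 0 <= p -> 0 <= q -> s <= p -> s <= q ->
  s <= Num.sqrt (p * q).
Proof.
move=> p0 q0 sp sq; have [s0|/ltW s0] := leP s 0.
  exact: le_trans s0 (sqrtr_ge0 _).
by rewrite -[leLHS]ger0_norm// -sqrtr_sqr ler_sqrt ?mulr_ge0// expr2 ler_pM.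
Qed.

Lemma sqrt_mul_le M p q : 0 <= p -> 0 <= q -> p <= M -> q <= M ->
  Num.sqrt (p * q) <= M.
Proof.
move=> p0 q0 pM qM; have M0 := le_trans p0 pM.
rewrite -[leRHS]ger0_norm// -sqrtr_sqr ler_sqrt ?sqr_ge0//.
by rewrite expr2 ler_pM.
Qed.

End GeometricMean.

Section ProductOfNorms.
Set Implicit Arguments.
Unset Strict Implicit.
Variables (R : realType) (X : normedModType R) (kappa tau : R).
Hypotheses (kappa0 : 0 < kappa) (tau0 : 0 < tau).

Definition T2_term (x1 x2 : X) : R :=
  Num.sqrt (`|kappa *: x1 + tau *: x2| * `|tau *: x1 - kappa *: x2|).

Lemma T2_term_le (x1 x2 : X) : `|x1| = 1 -> `|x2| = 1 ->
  T2_term x1 x2 <= kappa + tau.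
Proof.
move=> e1 e2; apply: sqrt_mul_le => //.
  by apply: norm_comb_le_add => //; exact: ltW.
rewrite -scalerN [leRHS]addrC.
by apply: norm_comb_le_add; rewrite ?normrN//; exact: ltW.
Qed.

Lemma T2_term_ge (x1 x2 : X) (d : R) : `|x1| = 1 -> `|x2| = 1 ->
  2 - d <= `|x1 + x2| -> 2 - d <= `|x1 - x2| ->
  kappa + tau - Num.max kappa tau * d <= T2_term x1 x2.
Proof.
move=> e1 e2 hp hm.
have M0 : 0 <= Num.max kappa tau by rewrite le_max (ltW kappa0).
have [k0 t0] := (ltW kappa0, ltW tau0).
have e2N : `|- x2| = 1 by rewrite normrN.
apply: le_sqrt_mul => //.
  by apply: le_trans (norm_comb_ge _ _ _ _) => //; nra.
rewrite -[- (kappa *: x2)]scalerN.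
apply: le_trans (norm_comb_ge _ _ _ _) => //.
rewrite [Num.max tau _]maxC; nra.
Qed.

(** A single factor with a defect suffices: the other one is at most
    kappa + tau. *)
Lemma T2_term_le_defect (x1 x2 : X) (d : R) : `|x1| = 1 -> `|x2| = 1 ->
  Num.min `|x1 + x2| `|x1 - x2| <= 2 - d ->
  T2_term x1 x2 <=
    Num.sqrt ((kappa + tau) * (kappa + tau - Num.min kappa tau * d)).
Proof.
move=> e1 e2 hd.
have m0 : 0 <= Num.min kappa tau by rewrite le_min !ltW.
have [k0 t0] := (ltW kappa0, ltW tau0).
have e2N : `|- x2| = 1 by rewrite normrN.
have pM := norm_comb_le_add e1 e2 k0 t0.
have qM := norm_comb_le_add e1 e2N t0 k0.
have pd := norm_comb_le e1 e2 k0 t0.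
have qd := norm_comb_le e1 e2N t0 k0.
rewrite minC in qd; rewrite scalerN in qM qd.
rewrite (addrC tau) in qM qd.
apply: ler_wsqrtr; move: hd; rewrite ge_min => /orP[hd|hd].
  rewrite mulrC; apply: ler_pM => //; apply: le_trans pd _; nra.
apply: ler_pM => //; apply: le_trans qd _; nra.
Qed.

End ProductOfNorms.

Theorem proposition4 (R : realType) (X : completeNormedModType R)
    (kappa tau : R) (hX : dim_ge X 2) (hkappa : 0 < kappa) (htau : 0 < tau) :
  ~ uniformly_nonsquare X <-> T2 kappa tau X = kappa + tau.
Proof.
set E := [set t | exists x1 x2 : X, [/\ unit_sphere x1, unit_sphere x2 &
  t = T2_term kappa tau x1 x2]]%classic.
have -> : T2 kappa tau X = sup E by [].
have half2 (z : X) : `|2^-1 *: z| = 2^-1 * `|z|.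
  by rewrite normrZ ger0_norm ?invr_ge0.
have ubE : ubound E (kappa + tau).
  by move=> _ [x1 [x2 [e1 e2 ->]]]; exact: T2_term_le.
have M0 : 0 < Num.max kappa tau by rewrite lt_max hkappa.
have m0 : 0 < Num.min kappa tau by rewrite lt_min hkappa.
split=> [nonsq|supE [d [/andP[d0 d1] sq]]].
  have near e : 0 < e -> exists2 t, E t & kappa + tau - e <= t.
    move=> e0; set M := Num.max kappa tau in M0.
    (* chosen so that 0 < d < 1 and M * (2 * d) <= e *)
    pose d := e / (e + 2 * M).
    have D0 : 0 < e + 2 * M by lra.
    have dE : d * (e + 2 * M) = e by rewrite /d divfK// gt_eqF.
    have d0 : 0 < d by rewrite divr_gt0.
    have d1 : d < 1 by rewrite ltr_pdivrMr//; lra.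
    apply: contrapT => far; apply: nonsq; exists d; split; first by rewrite d0.
    move=> x1 x2 e1 e2; rewrite leNgt; apply/negP => big; apply: far.
    exists (T2_term kappa tau x1 x2); first by exists x1, x2.
    move: big; rewrite lt_min !half2 => /andP[hp hm].
    apply: le_trans (T2_term_ge (d := 2 * d) hkappa htau _ _ _ _) => //.
    - by rewrite -/M; nra.
    - lra.
    - lra.
  have [t0 Et0 _] := near 1 ltr01.
  apply/eqP; rewrite eq_le ge_sup//=; last by exists t0.
  apply/ler_addgt0Pr => e e0; have [t Et le_t] := near e e0.
  rewrite -lerBlDr; apply: le_trans le_t _.
  by apply: ub_le_sup => //; exists (kappa + tau).
have hsE : has_sup E.
  (* otherwise the supremum would take its default value 0 *)
  apply: contrapT => /sup_out sup0; move: supE; rewrite sup0; lra.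
pose r := Num.sqrt
  ((kappa + tau) * (kappa + tau - Num.min kappa tau * (2 * d))).
have r_lt : r < kappa + tau.
  have S0 : 0 < kappa + tau by lra.
  rewrite -[ltRHS]ger0_norm ?ltW// -sqrtr_sqr ltr_sqrt ?exprn_gt0//.
  by rewrite expr2 ltr_pM2l// ltrBlDr ltrDl mulr_gt0 ?mulr_gt0.
suff: sup E <= r by rewrite supE leNgt r_lt.
apply: ge_sup; first by case: hsE.
move=> _ [x1 [x2 [e1 e2 ->]]]; apply: T2_term_le_defect => //.
move: (sq x1 x2 e1 e2); rewrite !half2 !ge_min => /orP[h|h]; apply/orP.
  by left; lra.
by right; lra.
Qed.
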